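(* Let $q$ be such that $\pm q$ is a PV number (i.e. $q$ or $-q$ is a PV number), and let $a_1 < \cdots < a_k$ be distinct positive integers ($k \geq 1$). Let $\alpha \in \mathcal{O}_q$ be such that $1 \leq |\alpha|$ and $$H_q(\alpha) < |q|^{a_1}.$$ Then the numbers $$1, \ E_{q,a_1}(\alpha), \ \ldots, \ E_{q,a_k}(\alpha)$$ are linearly independent over the field $\mathbb{Q}(q)$.
   Context: A real algebraic integer $\omega$ is called a Pisot–Vijayraghavan number (PV number) if $\omega > 1$ and all other Galois conjugates $\omega^{(j)}$ of $\omega$ satisfy $|\omega^{(j)}| < 1$ (in particular, integers greater than $1$ are PV numbers). For an algebraic integer $q \neq 0$, $n_q = [\mathbb{Q}(q):\mathbb{Q}]$; $\sigma_1, \ldots, \sigma_{n_q}$ denote the embeddings of $\mathbb{Q}(q)$ into $\mathbb{C}$, with $\sigma_1$ the identity; $\mathcal{O}_q$ is the ring of integers of $\mathbb{Q}(q)$. For $\alpha \in \mathbb{Q}(q)$, the $q$-relative height is $$H_q(\alpha) = \prod_{l=1}^{n_q} \max\{1, |\sigma_l(\alpha)|\}.$$ For $q$ with $|q| > 1$, set $[n]_q = q^n - 1$ and $[n]_q! = (q^n-1)(q^{n-1}-1)\cdots(q-1)$. For a positive integer $M$, define the entire function $$E_{q,M}(x) = 1 + \sum_{n=1}^{\infty} \frac{x^n}{[Mn]_q!}.$$ *)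

(* Defs.v *)
From HB Require Import structures.
From mathcomp Require Import all_boot all_order all_algebra.
From mathcomp Require Import complex.
From mathcomp Require Import all_classical all_reals all_analysis.

Set Implicit Arguments.
Unset Strict Implicit.
Unset Printing Implicit Defensive.

Import Order.TTheory GRing.Theory Num.Theory.
Import numFieldNormedType.Exports.

Local Open Scope ring_scope.
Local Open Scope classical_set_scope.

Section SimpleExtension.
Variable R : realType.
Implicit Types q x : R.

(* The smallest subfield of R containing q: divring_closed S says that S
   contains 1 and is stable under subtraction and division. *)
Definition in_adjoin q : {pred R} :=
  fun x => `[< forall S : {pred R}, divring_closed S -> q \in S -> x \in S >].

Lemma in_adjoin_divring_closed q : divring_closed (in_adjoin q).
Proof.
split.
- by apply/asboolP => S [].
- move=> x y /asboolP Sx /asboolP Sy; apply/asboolP => S clS Sq.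
  by case: (clS) => _ subS _; apply: subS; [apply: Sx | apply: Sy].
- move=> x y /asboolP Sx /asboolP Sy; apply/asboolP => S clS Sq.
  by case: (clS) => _ _ divS; apply: divS; [apply: Sx | apply: Sy].
Qed.

HB.instance Definition _ q :=
  GRing.isDivringClosed.Build R (in_adjoin q) (in_adjoin_divring_closed q).

Record adjoin q := Adjoin { adjoin_val : R; _ : adjoin_val \in in_adjoin q }.

HB.instance Definition _ q := [isSub for @adjoin_val q].
HB.instance Definition _ q := [Choice of adjoin q by <:].
HB.instance Definition _ q := [SubChoice_isSubIntegralDomain of adjoin q by <:].
HB.instance Definition _ q := [SubIntegralDomain_isSubField of adjoin q by <:].

Definition ring_of_integers q : set (adjoin q) :=
  [set a | integralOver (intr : int -> adjoin q) a].

(* Field homomorphisms, viewed as plain functions so that they form a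
   choiceType and can index a product. *)
Definition embeddings q : set (adjoin q -> R[i]) :=
  [set s : adjoin q -> R[i] | exists f : {rmorphism adjoin q -> R[i]}, s = f].

(* The product over a set is 1 by convention when infinitely many factors
   differ from 1; for algebraic q there are only [Q(q) : Q] embeddings. *)
Definition rel_height q (a : adjoin q) : R :=
  \big[*%R/1]_(s \in @embeddings q) Num.max 1 (ComplexField.Normc.normc (s a)).

End SimpleExtension.
Arguments ring_of_integers {R} q _.
Arguments embeddings {R} q _.

Section PisotNumbers.
Variable R : realType.
Implicit Types w : R.

Definition is_min_poly w (p : {poly rat}) : Prop :=
  [/\ p \is monic, irreducible_poly p & root (map_poly ratr p) w].

Definition galois_conjugate w (z : R[i]) : Prop :=
  exists2 p : {poly rat}, is_min_poly w p & root (map_poly ratr p) z.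

Definition PV_number w : Prop :=
  [/\ integralOver (intr : int -> R) w, 1 < w &
      forall z : R[i], galois_conjugate w z -> z != real_complex R w ->
        ComplexField.Normc.normc z < 1].

End PisotNumbers.

Section QExponential.
Variable R : realType.
Implicit Types q x : R.

Definition qfact q (n : nat) : R := \prod_(1 <= i < n.+1) (q ^+ i - 1).

(* For |q| > 1 and M > 0 the series converges, and no denominator vanishes. *)
Definition qexp q (M : nat) x : R :=
  1 + limn (fun N => \sum_(1 <= n < N) (x ^+ n / qfact q (M * n))).

End QExponential.

Definition lin_indep_over (R : realType) (q : R) (I : finType) (v : I -> R) :
    Prop :=
  forall c : I -> adjoin q,
    \sum_(i : I) val (c i) * v i = 0 -> forall i : I, c i = 0.

(* Main.v *)
From HB Require Import structures.
Require Import Defs.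
From mathcomp Require Import all_boot all_order all_algebra all_field.
From mathcomp Require polyorder.
From mathcomp Require Import complex.
From mathcomp Require Import all_classical all_reals all_analysis.
From mathcomp Require Import ring lra zify.
Import Order.TTheory GRing.Theory Num.Theory.
Import numFieldNormedType.Exports.
Local Open Scope ring_scope.
Local Open Scope classical_set_scope.

(** The proof forces an algebraic integer of Q(q) to be so small that it
    vanishes. Suppose c_0 + sum_j c_j E_j = 0, where E_j is the q-exponential of
    step a_j at alpha; clearing denominators, the c_i may be taken integral over
    Z. Order the terms of the linear form by the q-factorial that occurs in
    them: it becomes sum_m b_m / [m]_q!, where b_0 also contains c_0 and
    otherwise b_m is the sum of the c_j alpha^(m / a_j) over the j such that a_j
    divides m. Let T_N = [N]_q! * sum_(m <= N) b_m / [m]_q!, which is integral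
    over Z because T_(N+1) = (q^(N+1) - 1) T_N + b_(N+1).

    Write M = N %/ a_1, and for an embedding s of Q(q) into the complex numbers
    let h_s = max(1, |s alpha|). Then |s b_m| is O(h_s^(m %/ a_1)).
    - If |s q| < 1, the factors |s q|^i + 1 have a convergent product, and the
      recurrence gives |s T_N| = O((N + 1) h_s^M) (recurrence_growth).
    - For the real place the sum of the whole series is 0, so T_N is, up to
      sign, [N]_q! times the tail of the series, which is dominated by its first
      term: |T_N| = O(h^M / |q|^(a_1 M)) (cleared_sum_tail).
    The Pisot hypothesis says that there are no other embeddings
    (PV_conjugates). Multiplying, the norm of T_N is
    O((N + 1)^d (H_q(alpha) / |q|^(a_1))^M), which tends to 0. The norm of a
    nonzero algebraic integer is a nonzero integer (embeddings_enum), so T_N = 0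
    for all large N (cleared_sum_eventually0).

    The recurrence now gives b_N = 0 for all large N. Choosing N congruent to
    a_j modulo every a_i, the only terms of b_N besides c_j alpha^(N / a_j) have
    an index i < j, so the c_j vanish one after the other
    (eventually0_form_coef); then c_0 = 0 as well. *)
Set Implicit Arguments.
Unset Strict Implicit.
Unset Printing Implicit Defensive.

Local Notation normc := ComplexField.Normc.normc.

(** * Rational polynomials and norms *)

(** Over the rationals, an irreducible polynomial with root [x] generates the
    ideal of the polynomials that vanish at [x]: one that it does not divide is
    coprime to it, and coprime polynomials have no common root. *)
Lemma root_irreducible (F : numFieldType) (p g : {poly rat}) (x : F) :
    irreducible_poly p -> root (map_poly ratr p) x ->
  root (map_poly ratr g) x = (p %| g).
Proof.
move=> p_irr px0; apply/idP/idP=> [gx0 | /dvdpP[h ->]]; last first.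
  by rewrite rmorphM /= rootM px0 orbT.
apply: contraLR gx0 => ndiv.
have: coprimep p g by rewrite irreducible_poly_coprime.
rewrite -(coprimep_map (ratr : {rmorphism rat -> F})) => cop.
exact: (coprimep_root cop px0).
Qed.

(** In characteristic 0 an irreducible polynomial is prime to its derivative,
    which is nonzero and of smaller degree. *)
Lemma irreducible_uniq_roots (F : numFieldType) (p : {poly rat}) (rs : seq F) :
    irreducible_poly p -> map_poly ratr p = \prod_(z <- rs) ('X - z%:P) ->
  uniq rs.
Proof.
move=> p_irr pE; rewrite -separable_prod_XsubC -pE separable_map.
rewrite unlock irreducible_poly_coprime //.
have p0 := irredp_neq0 p_irr.
rewrite gtNdvdp ?lt_size_deriv // -size_poly_eq0.
by rewrite polyorder.size_deriv; case: p_irr => + _; case: size => [|[]].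
Qed.

(** The product over the roots of [p] is the norm of the class of [g], that is
    the determinant of multiplication by [g] on Q[X] / (p), a matrix [M] with
    rational entries. Evaluation at the roots diagonalizes this multiplication:
    the change of basis is the Vandermonde matrix of the roots, which is
    invertible since they are distinct. *)
Lemma prod_horner_rat (F : numFieldType) (p g : {poly rat}) (rs : seq F) :
    p \is monic -> uniq rs -> map_poly ratr p = \prod_(z <- rs) ('X - z%:P) ->
  exists r : rat, \prod_(z <- rs) (map_poly ratr g).[z] = ratr r.
Proof.
move=> p_mon rs_uniq pE; pose d := size rs.
have p0 : p != 0 by apply: monic_neq0.
have szp : size p = d.+1.
  rewrite -(size_map_poly (ratr : {rmorphism rat -> F})) pE.
  exact: size_prod_XsubC.
pose M := \matrix_(j < d, k < d) ('X^j * g %% p)`_k.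
pose v : 'rV[F]_d := \row_l rs`_l.
pose V := Vandermonde d v.
pose D := diag_mx (\row_(l < d) (map_poly ratr g).[rs`_l]).
exists (\det M).
(* Row [j]: evaluate at each root the remainder of ['X^j * g] modulo [p]. *)
have VM : map_mx ratr M *m V = V *m D.
  apply/matrixP => j l; rewrite mul_mx_diag !mxE.
  have pz0 : (map_poly ratr p).[rs`_l] = 0.
    by apply/rootP; rewrite pE root_prod_XsubC mem_nth.
  have := congr1 (fun h => (map_poly ratr h).[rs`_l]) (divp_eq ('X^j * g) p).
  rewrite rmorphD !rmorphM /= hornerD !hornerM pz0 mulr0 add0r map_polyXn hornerXn => ->.
  have ltd : (size ('X^j * g %% p)%R <= d)%N by rewrite -ltnS -szp ltn_modp.
  rewrite (@horner_coef_wide _ d) ?size_map_poly //; apply: eq_bigr => k _.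
  by rewrite !mxE coef_map.
have V0 : \det V != 0.
  rewrite det_Vandermonde; apply/prodf_neq0 => i _; apply/prodf_neq0 => j ltij.
  by rewrite !mxE subr_eq0 nth_uniq // gtn_eqF.
apply: (mulfI V0); rewrite (big_nth 0) big_mkord.
have -> : \prod_(i < size rs) (map_poly ratr g).[rs`_i] = \det D.
  by rewrite det_diag; apply: eq_bigr => i _; rewrite mxE.
by rewrite -det_mulmx -VM det_mulmx det_map_mx mulrC.
Qed.

(** Z is integrally closed in Q. The result for algebraic complex numbers is
    transported along the two embeddings of Q. *)
Lemma integral_rat_int (F : numFieldType) (r : rat) :
  integralOver (intr : int -> F) (ratr r) -> exists m : int, r = m%:~R.
Proof.
case=> f f_mon fr0; have: (ratr r : algC) \in Num.int.
  apply: Cint_rat_Aint; first exact: Crat_rat.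
  apply: (@root_monic_Aint (map_poly intr f)).
  - have: root (map_poly intr f) r.
      rewrite -(fmorph_root (ratr : {rmorphism rat -> F})) -map_poly_comp.
      by rewrite (eq_map_poly (g := intr)) // => b; rewrite /= ratr_int.
    rewrite -(fmorph_root (ratr : {rmorphism rat -> algC})) -map_poly_comp.
    by rewrite (eq_map_poly (g := intr)) // => b; rewrite /= ratr_int.
  - exact: monic_map.
  - by apply/polyOverP => i; rewrite coef_map /= rpred_int.
case/intrP => m rm; exists m; apply: (fmorph_inj (ratr : {rmorphism rat -> algC})).
by rewrite /= rm ratr_int.
Qed.

(** * The complex modulus *)

Lemma normc_real (R : realType) (x : R) : normc (real_complex R x) = `|x|.
Proof. by rewrite /ComplexField.Normc.normc /= expr0n addr0 sqrtr_sqr. Qed.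

Lemma normc_opp (R : realType) (x : R[i]) : normc (- x) = normc x.
Proof. exact: normcN. Qed.

Lemma normc_add (R : realType) (x y : R[i]) :
  normc (x + y) <= normc x + normc y.
Proof. exact: le_normcD. Qed.

Lemma normc_ge0 (R : realType) (x : R[i]) : 0 <= normc x.
Proof. by case: x => u v; apply: sqrtr_ge0. Qed.

Lemma normc_exp (R : realType) (x : R[i]) n : normc (x ^+ n) = normc x ^+ n.
Proof.
elim: n => [|n IHn]; first exact: ComplexField.Normc.normc1.
by rewrite !exprS ComplexField.Normc.normcM IHn.
Qed.

Lemma normc_prod (R : realType) (I : Type) (r : seq I) (F : I -> R[i]) :
  normc (\prod_(i <- r) F i) = \prod_(i <- r) normc (F i).
Proof.
elim: r => [|i r IHr]; first by rewrite !big_nil ComplexField.Normc.normc1.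
by rewrite !big_cons ComplexField.Normc.normcM IHr.
Qed.

(** * Embeddings of Q(q) and the norm inequality *)

Lemma integral_intr_rmorph (A B : nzRingType) (f : {rmorphism A -> B}) (x : A) :
  integralOver (intr : int -> A) x -> integralOver (intr : int -> B) (f x).
Proof.
move=> /(integral_rmorph f) [p p_mon px0]; exists p => //.
by rewrite (eq_map_poly (g := f \o intr)) // => b /=; rewrite rmorph_int.
Qed.

Lemma rmorph_horner_intr (A B : nzRingType) (f : {rmorphism A -> B})
    (h : {poly int}) (x : A) :
  f (map_poly intr h).[x] = (map_poly intr h).[f x].
Proof.
rewrite -horner_map -map_poly_comp; congr (_.[_]).
by apply: eq_map_poly => b /=; rewrite rmorph_int.
Qed.

Lemma map_ratr_intr (F : numFieldType) (h : {poly int}) :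
  map_poly ratr (map_poly intr h) = map_poly intr h :> {poly F}.
Proof.
by rewrite -map_poly_comp; apply: eq_map_poly => b /=; rewrite ratr_int.
Qed.

Section Adjoin.
Variables (R : realType) (q : R).

Lemma in_adjoin_self : q \in in_adjoin q.
Proof. by apply/asboolP. Qed.

Definition adjoin_gen : adjoin q := Adjoin in_adjoin_self.

(** The minimal polynomial is found over the algebraically closed field [R[i]],
    where [minPoly_decidable_closure] applies because membership in Q is decided
    classically. *)
Lemma min_poly_exists :
  integralOver (intr : int -> R) q -> exists p : {poly rat}, is_min_poly q p.
Proof.
move=> /(integral_intr_rmorph (real_complex R)) [f f_mon fq0].
have dec : decidable_embedding (ratr : rat -> R[i]).
  by move=> y; case: (pselect (exists x, y = ratr x)) => h; [left | right].
have qint : integralOver (ratr : rat -> R[i]) (real_complex R q).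
  exists (map_poly intr f); first exact: monic_map.
  by rewrite map_ratr_intr.
have [p [p_mon pq0 p_irr]] := minPoly_decidable_closure dec qint.
exists p; split=> //; move: pq0.
rewrite (eq_map_poly (g := real_complex R \o ratr)); last first.
  by move=> r; rewrite [RHS](fmorph_rat (real_complex R)).
by rewrite map_poly_comp fmorph_root.
Qed.

Variable p : {poly rat}.
Hypothesis p_min : is_min_poly q p.

Let p_irr : irreducible_poly p. Proof. by case: p_min. Qed.
Let pq0 : root (map_poly ratr p) q. Proof. by case: p_min. Qed.

(** Q(q) = Q[q]: the values at [q] of rational polynomials are closed under
    division, because a Bezout relation with [p] inverts any nonzero value. *)
Lemma adjoin_horner (x : adjoin q) :
  exists g : {poly rat}, val x = (map_poly ratr g).[q].
Proof.
have xin : forall S : {pred R}, divring_closed S -> q \in S -> val x \in S.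
  exact: asboolW (valP x).
pose S : {pred R} := fun y => `[< exists g : {poly rat}, y = (map_poly ratr g).[q] >].
suff: val x \in S by move/asboolW.
apply: xin.
- split.
  + by apply/asboolP; exists 1; rewrite rmorph1 hornerC.
  + move=> y z /asboolP[g ->] /asboolP[h ->]; apply/asboolP.
    by exists (g - h); rewrite rmorphB hornerD hornerN.
  + move=> y z /asboolP[g ->] /asboolP[h ->]; apply/asboolP.
    have [ph | nph] := boolP (p %| h).
      exists 0; rewrite rmorph0 horner0.
      by move: ph; rewrite -(root_irreducible h p_irr pq0) => /rootP->; rewrite invr0 mulr0.
    have := nph; rewrite -(irreducible_poly_coprime h p_irr) => /Bezout_eq1_coprimepP[[u v] uv1].
    exists (g * v); rewrite rmorphM hornerM; congr (_ * _).
    have := congr1 (fun h => (map_poly ratr h).[q]) uv1.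
    rewrite rmorphD !rmorphM rmorph1 /= hornerD !hornerM (rootP pq0) mulr0 add0r hornerC.
    move=> vh; rewrite -[LHS]mul1r -vh mulfK //.
    by rewrite -/(root _ _) (root_irreducible h p_irr pq0).
- by apply/asboolP; exists 'X; rewrite map_polyX hornerX.
Qed.

(** The field [adjoin q] carries no order, so [ratr] is not known to be a ring
    morphism into it. Multiplying by an integer reduces statements on rational
    polynomials to integer polynomials, whose coefficients every ring morphism
    respects. *)
Lemma adjoin_scale_int (g : {poly rat}) (x : adjoin q) :
    val x = (map_poly ratr g).[q] ->
  exists (D : int) (h : {poly int}),
    [/\ D != 0, D%:~R *: g = map_poly intr h & D%:~R * x = (map_poly intr h).[adjoin_gen]].
Proof.
have [h [D D0 ->]] := rat_poly_scale g => xE.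
have gE : D%:~R *: (D%:~R^-1 *: map_poly intr h) = map_poly intr h :> {poly rat}.
  by rewrite scalerA divff ?scale1r // intr_eq0.
exists D, h; split=> //.
apply: val_inj; rewrite [LHS]rmorphM [X in X * _]rmorph_int [RHS]rmorph_horner_intr.
rewrite [LHS](congr1 (fun t => D%:~R * t) xE) -[RHS]/((map_poly intr h).[q]).
by rewrite -[in RHS]map_ratr_intr -[in RHS]gE [in RHS]map_polyZ hornerZ /= ratr_int.
Qed.

Lemma embedding_horner (F : numFieldType) (f : {rmorphism adjoin q -> F})
    (g : {poly rat}) (x : adjoin q) :
  val x = (map_poly ratr g).[q] -> f x = (map_poly ratr g).[f adjoin_gen].
Proof.
move=> /adjoin_scale_int[D [h [D0 gE xE]]].
have D0F : D%:~R != 0 :> F by rewrite intr_eq0.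
apply: (mulfI D0F); have := congr1 f xE.
rewrite rmorphM rmorph_int rmorph_horner_intr => ->.
by rewrite -[in LHS]map_ratr_intr -[in LHS]gE [in LHS]map_polyZ hornerZ /= ratr_int.
Qed.

Lemma embedding_root (F : numFieldType) (f : {rmorphism adjoin q -> F}) :
  root (map_poly ratr p) (f adjoin_gen).
Proof.
by apply/rootP; rewrite -(@embedding_horner _ _ _ 0) ?rmorph0 // (rootP pq0).
Qed.

(** The element g(q) is sent to g(z). The choice of [g] does not matter: if two
    polynomials agree at [q], then [p] divides their difference, so that they
    agree at [z]. *)
Lemma embedding_of_root (F : numFieldType) (z : F) :
    root (map_poly ratr p) z ->
  exists f : {rmorphism adjoin q -> F}, f adjoin_gen = z.
Proof.
move=> pz0; have [G GE] := choice adjoin_horner.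
pose f x := (map_poly ratr (G x)).[z].
have fE x g : val x = (map_poly ratr g).[q] -> f x = (map_poly ratr g).[z].
  rewrite GE => /eqP; rewrite -subr_eq0 -hornerN -hornerD -rmorphB.
  rewrite -/(root _ _) (root_irreducible _ p_irr pq0).
  rewrite -(root_irreducible _ p_irr pz0) rootE rmorphB hornerD hornerN subr_eq0.
  by move/eqP.
have hB (K : numFieldType) g h (y : K) : (map_poly ratr (g - h)).[y] =
    (map_poly ratr g).[y] - (map_poly ratr h).[y].
  by rewrite rmorphB hornerD hornerN.
have hM (K : numFieldType) g h (y : K) : (map_poly ratr (g * h)).[y] =
    (map_poly ratr g).[y] * (map_poly ratr h).[y].
  by rewrite rmorphM hornerM.
have f_sub : zmod_morphism f.
  move=> x y; rewrite (@fE _ (G x - G y)) ?hB // -!GE; exact: rmorphB.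
have f_mul : monoid_morphism f.
  split; first by rewrite (@fE _ 1) ?rmorph1 ?hornerC.
  move=> x y; rewrite (@fE _ (G x * G y)) ?hM // -!GE; exact: rmorphM.
pose fA := GRing.isZmodMorphism.Build _ _ f f_sub.
pose fM := GRing.isMonoidMorphism.Build _ _ f f_mul.
pose fR : {rmorphism adjoin q -> F} := HB.pack f fA fM.
by exists fR; rewrite /= (@fE _ 'X) map_polyX hornerX.
Qed.
End Adjoin.

Lemma integral_prod (A : comNzRingType) (I : eqType) (r : seq I) (F : I -> A) :
    {in r, forall i, integralOver (intr : int -> A) (F i)} ->
  integralOver (intr : int -> A) (\prod_(i <- r) F i).
Proof.
move=> Fint; rewrite big_seq; apply: big_ind => //.
- exact: integral1.
- by move=> x y; apply: integral_mul.
Qed.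

(** There are finitely many embeddings, since they correspond to the roots of
    the minimal polynomial; in particular the product that defines the relative
    height is a genuine finite product. The inequality holds because the product
    of the conjugates of [x] is rational and integral over Z, hence an integer,
    and no conjugate of a nonzero element vanishes. *)
Lemma embeddings_enum (R : realType) (q : R) :
    integralOver (intr : int -> R) q ->
  exists ss : seq (adjoin q -> R[i]),
    [/\ uniq ss, embeddings q = [set` ss] &
      forall x : adjoin q, integralOver (intr : int -> adjoin q) x -> x != 0 ->
        1 <= \prod_(s <- ss) normc (s x)].
Proof.
move=> /min_poly_exists[p p_min]; have [p_mon p_irr pq0] := p_min.
have [rs pE] := closed_field_poly_normal (map_poly ratr p : {poly R[i]}).
have {}pE : map_poly ratr p = \prod_(z <- rs) ('X - z%:P) :> {poly R[i]}.
  by rewrite pE (monicP (monic_map _ p_mon)) scale1r.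
have rs_uniq := irreducible_uniq_roots p_irr pE.
have rsP z : (z \in rs) = root (map_poly ratr p) z by rewrite pE root_prod_XsubC.
have /choice[phi phiP] : forall z : R[i], exists f : adjoin q -> R[i], z \in rs ->
    f (adjoin_gen q) = z /\ embeddings q f.
  move=> z; have [zrs | nzrs] := boolP (z \in rs); last by exists (fun=> 0).
  rewrite rsP in zrs; have [f fz] := embedding_of_root p_min zrs.
  by exists f; split=> //; exists f.
exists [seq phi z | z <- rs]; split.
- rewrite map_inj_in_uniq // => y z yrs zrs yz.
  by rewrite -(phiP y yrs).1 yz (phiP z zrs).1.
- apply/seteqP; split=> [_ [f ->] | _ /mapP[z zrs ->]]; last exact: (phiP z zrs).2.
  have zrs : f (adjoin_gen q) \in rs by rewrite rsP; apply: embedding_root.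
  apply/mapP; exists (f (adjoin_gen q)) => //.
  have [phig [h hE]] := phiP _ zrs; rewrite hE in phig *.
  apply/funext => x; have [g gE] := adjoin_horner p_min x.
  by rewrite !(embedding_horner _ gE) phig.
- move=> x x_int x0; have [g gE] := adjoin_horner p_min x.
  have phiE z : z \in rs -> phi z x = (map_poly ratr g).[z].
    move=> zrs; have [phig [h hE]] := phiP z zrs; rewrite hE in phig *.
    by rewrite (embedding_horner _ gE) phig.
  have [r rE] := prod_horner_rat g p_mon rs_uniq pE.
  have prodE : \prod_(z <- rs) phi z x = ratr r.
    by rewrite -rE; apply: eq_big_seq.
  have [m rm] : exists m : int, r = m%:~R.
    apply: (@integral_rat_int R[i]); rewrite -prodE; apply: integral_prod => z zrs.
    by have [_ [h ->]] := phiP z zrs; apply: integral_intr_rmorph.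
  have m0 : m != 0.
    apply: contraNneq x0 => m0; move: prodE; rewrite rm m0 rmorph0 => /eqP.
    rewrite prodf_seq_eq0 => /hasP[z zrs]; rewrite phiE //=.
    rewrite -/(root _ _) (root_irreducible _ p_irr); last by rewrite -rsP.
    rewrite -(root_irreducible _ p_irr pq0) => /rootP; rewrite -gE => x0.
    by apply/eqP/val_inj; rewrite rmorph0.
  rewrite big_map -normc_prod prodE rm ratr_int.
  have -> : m%:~R = real_complex R m%:~R by rewrite rmorph_int.
  rewrite normc_real -intr_norm -[1]/(1%:~R) ler_int.
  by rewrite -gtz0_ge1 normr_gt0.
Qed.

(** An embedding that fixes [q] is the inclusion in the reals followed by that
    in the complex numbers. Any other one sends [q] to a conjugate of [q]
    different from [q], and negation exchanges the conjugates of [q] with those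
    of [- q]: this treats both signs. *)
Lemma PV_conjugates (R : realType) (q : R) : PV_number q \/ PV_number (- q) ->
  [/\ integralOver (intr : int -> R) q, 1 < `|q| &
     forall s : adjoin q -> R[i], embeddings q s ->
       s = real_complex R \o val \/ normc (s (adjoin_gen q)) < 1].
Proof.
move=> PVq.
have q_int : integralOver (intr : int -> R) q.
  by case: PVq => -[qint _ _] //; rewrite -[q]opprK; apply: integral_opp.
split=> //.
  by case: PVq => -[_ q1 _]; [|rewrite -normrN]; apply: lt_le_trans (ler_norm _).
have [p p_min] := min_poly_exists q_int; have [p_mon p_irr pq0] := p_min.
move=> _ [f ->]; have pf0 := embedding_root p_min f.
have [fq | nfq] := eqVneq (f (adjoin_gen q)) (real_complex R q).
  left; apply/funext => x; have [g gE] := adjoin_horner p_min x.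
  rewrite (embedding_horner _ gE) fq /= gE -horner_map -map_poly_comp.
  by congr (_.[_]); apply: eq_map_poly => c /=; rewrite fmorph_rat.
right; case: PVq => -[wint _ conj]; first by apply: conj => //; exists p.
rewrite -normc_opp; apply: conj; last by rewrite rmorphN eqr_opp.
(* Composing the minimal polynomial [p'] of [- q] with [- 'X] gives a rational
   polynomial that vanishes at [q], hence at [f q]. *)
have [p' p'_min] := min_poly_exists wint; exists p' => //.
have [_ _ p'q0] := p'_min.
have compN (F : numFieldType) (y : F) :
    root (map_poly ratr (p' \Po - 'X)) y = root (map_poly ratr p') (- y).
  by rewrite map_comp_poly rmorphN /= map_polyX rootE horner_comp hornerN hornerX.
by rewrite -compN (root_irreducible _ p_irr pf0) -(root_irreducible _ p_irr pq0) compN.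
Qed.

(** * Denominators *)

Lemma integral_adjoin_gen (R : realType) (q : R) :
    integralOver (intr : int -> R) q ->
  integralOver (intr : int -> adjoin q) (adjoin_gen q).
Proof.
case=> f f_mon fq0; exists f => //; apply/rootP/val_inj.
by rewrite [LHS]rmorph_horner_intr rmorph0; apply/rootP.
Qed.

(** If [D * g] has integer coefficients, then [D * g(q)] is an integral
    polynomial expression in the algebraic integer [q]. *)
Lemma adjoin_denominator (R : realType) (q : R) (x : adjoin q) :
    integralOver (intr : int -> R) q ->
  exists2 D : int, D != 0 & integralOver (intr : int -> adjoin q) (D%:~R * x).
Proof.
move=> q_int; have [p p_min] := min_poly_exists q_int.
have [g /adjoin_scale_int[D [h [D0 _ xE]]]] := adjoin_horner p_min x.
exists D => //; rewrite xE; apply: integral_horner; last exact: integral_adjoin_gen.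
apply/integral_poly => i; rewrite coef_map; exact: integral_id.
Qed.

Lemma adjoin_common_denominator (R : realType) (q : R) (I : finType)
    (c : I -> adjoin q) :
    integralOver (intr : int -> R) q ->
  exists2 D : int, D != 0 &
    forall i, integralOver (intr : int -> adjoin q) (D%:~R * c i).
Proof.
move=> q_int.
have /choice[D DP] : forall i, exists D : int, D != 0 /\
    integralOver (intr : int -> adjoin q) (D%:~R * c i).
  by move=> i; have [D ? ?] := adjoin_denominator (c i) q_int; exists D.
exists (\prod_i D i) => [|i]; first by apply/prodf_neq0 => i _; case: (DP i).
rewrite (bigD1 i) //= mulrC intrM mulrA.
apply: integral_mul; last exact: integral_id.
by rewrite mulrC; case: (DP i).
Qed.

(** * Partial sums cleared of their q-factorials *)

(** This is [N]_r! * sum_(m <= N) b_m / [m]_r! (see [cleared_sumE]), written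
    without division: it makes sense in any ring, commutes with ring morphisms,
    and is visibly integral over Z when [r] and [b] are. *)
Fixpoint cleared_sum (A : nzRingType) (r : A) (b : nat -> A) (N : nat) : A :=
  if N is N'.+1 then (r ^+ N - 1) * cleared_sum r b N' + b N else b 0%N.

Lemma rmorph_cleared_sum (A B : nzRingType) (f : {rmorphism A -> B}) r b N :
  f (cleared_sum r b N) = cleared_sum (f r) (f \o b) N.
Proof.
elim: N => [|N IHN] //=.
by rewrite rmorphD rmorphM rmorphB rmorph1 rmorphXn IHN.
Qed.

Lemma integral_cleared_sum (A : comNzRingType) (r : A) (b : nat -> A) N :
    integralOver (intr : int -> A) r ->
    (forall n, integralOver (intr : int -> A) (b n)) ->
  integralOver (intr : int -> A) (cleared_sum r b N).
Proof.
move=> r_int b_int; elim: N => [|N IHN] //=.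
apply: integral_add => //; apply: integral_mul => //.
apply: integral_sub; last exact: integral1.
elim: N.+1 => [|n IHn]; first exact: integral1.
by rewrite exprS; apply: integral_mul.
Qed.

(** * Growth of the conjugates *)

Section Growth.
Variable R : realType.

(** Each of the [m + 1] first terms of the geometric series of sum
    [(1 - x)^-1] is at least [x ^+ m]. *)
Lemma natr_mul_exprn_le (x : R) (m : nat) :
  0 <= x -> x < 1 -> m.+1%:R * x ^+ m <= (1 - x)^-1.
Proof.
move=> x0 x1; have y0 : 0 < 1 - x by rewrite subr_gt0.
rewrite -[leRHS]mul1r ler_pdivlMr // -mulrA.
apply: (@le_trans _ _ (\sum_(i < m.+1) x ^+ i * (1 - x))).
  rewrite mulr_natl -[X in _ *+ X]card_ord -sumr_const; apply: ler_sum => i _.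
  rewrite (ler_wpM2r (ltW y0)) //; apply: ler_wiXn2l => //; first exact: ltW.
  by rewrite -ltnS.
rewrite -mulr_suml mulrC -opprB mulNr -subrX1 opprB gerBl.
exact: exprn_ge0.
Qed.

(** By induction on [d]: one factor [m + 1] is absorbed by the ratio [x / y],
    where [y] lies strictly between [x] and 1. *)
Lemma poly_geom_bounded (d : nat) (x : R) : 0 <= x -> x < 1 ->
  exists2 K : R, 0 <= K & forall m, m.+1%:R ^+ d * x ^+ m <= K.
Proof.
elim: d x => [|d IHd] x x0 x1.
  by exists 1 => // m; rewrite mul1r exprn_ile1 // ltW.
pose y := (1 + x) / 2%:R; have y0 : 0 < y by rewrite /y; lra.
have y1 : y < 1 by rewrite /y; lra.
have xy : x < y by rewrite /y; lra.
have [K K0 KP] := IHd y (ltW y0) y1.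
have z0 : 0 <= x / y by rewrite divr_ge0 // ltW.
have z1 : x / y < 1 by rewrite ltr_pdivrMr // mul1r.
exists (K * (1 - x / y)^-1) => [|m].
  by rewrite mulr_ge0 // invr_ge0 subr_ge0 ltW.
have -> : m.+1%:R ^+ d.+1 * x ^+ m =
    (m.+1%:R ^+ d * y ^+ m) * (m.+1%:R * (x / y) ^+ m).
  rewrite exprS [(x / y) ^+ m]expr_div_n.
  have : y ^+ m != 0 by rewrite expf_neq0 // gt_eqF.
  by move=> ym; field.
apply: ler_pM; rewrite ?KP ?natr_mul_exprn_le ?mulr_ge0 ?exprn_ge0 ?ler0n //.
all: by rewrite ?invr_ge0 ltW.
Qed.

(** The bound for the exponent [d + 1] leaves a factor [m + 1] to spare. *)
Lemma poly_geom_small (d : nat) (x C : R) : 0 <= x -> x < 1 ->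
  exists m0, forall m, (m0 <= m)%N -> C * (m.+1%:R ^+ d * x ^+ m) < 1.
Proof.
move=> x0 x1; have [K K0 KP] := poly_geom_bounded d.+1 x0 x1.
exists (Num.truncn (`|C| * K)) => m /(leq_ltn_trans)-/(_ _ (leqnn _)) ltm.
have CK0 : 0 <= `|C| * K by rewrite mulr_ge0.
have ltCK : `|C| * K < m.+1%:R.
  apply: lt_le_trans (truncnS_gt _) _; rewrite ler_nat //.
have m0 : 0 < m.+1%:R :> R by rewrite ltr0n.
rewrite -(ltr_pM2l m0) mulr1; apply: le_lt_trans ltCK.
rewrite mulrCA; apply: le_trans (_ : `|C| * (m.+1%:R * (m.+1%:R ^+ d * x ^+ m)) <= _).
  by rewrite ler_wpM2r ?ler_norm // !mulr_ge0 ?exprn_ge0 ?ler0n.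
by rewrite ler_wpM2l // mulrA -exprS.
Qed.

Lemma prod_1X_bounded (x : R) : 0 <= x -> x < 1 ->
  forall N, \prod_(i < N) (1 + x ^+ i.+1) <= expR (1 - x)^-1.
Proof.
move=> x0 x1 N; have y0 : 0 < 1 - x by rewrite subr_gt0.
apply: (@le_trans _ _ (expR (\sum_(i < N) x ^+ i.+1))).
  rewrite expR_sum; apply: ler_prod => i _.
  by rewrite addr_ge0 ?exprn_ge0 ?expR_ge1Dx.
rewrite ler_expR -[leRHS]mul1r ler_pdivlMr //.
have -> : \sum_(i < N) x ^+ i.+1 = x * \sum_(i < N) x ^+ i.
  by rewrite mulr_sumr; apply: eq_bigr => i _; rewrite exprS.
rewrite -mulrA [_ * (1 - x)]mulrC -opprB mulNr -subrX1 opprB.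
rewrite -[leRHS]mulr1; apply: ler_pM => //; first by rewrite subr_ge0 exprn_ile1 // ltW.
  exact: ltW.
by rewrite gerBl exprn_ge0.
Qed.

(** The moduli of the conjugates of [cleared_sum] satisfy such an inequality.
    The multipliers [1 + x ^+ N] have a bounded product, so that [e N] is at most
    a constant times the sum of the [N + 1] inhomogeneous terms, of which the
    last is the largest. *)
Lemma recurrence_growth (x h B : R) (a : nat) (e : nat -> R) :
    0 <= x -> x < 1 -> 1 <= h -> 0 <= B ->
    e 0%N <= B ->
    (forall N, e N.+1 <= (1 + x ^+ N.+1) * e N + B * h ^+ (N.+1 %/ a)) ->
  exists2 K, 0 <= K & forall N, e N <= K * N.+1%:R * h ^+ (N %/ a).
Proof.
move=> x0 x1 h1 B0 e0 eS; have h0 : 0 <= h by apply: le_trans h1.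
exists (expR (1 - x)^-1 * B) => [|N]; first by rewrite mulr_ge0 ?expR_ge0.
pose P n := \prod_(i < n) (1 + x ^+ i.+1).
have P1 n : 1 <= P n.
  rewrite /P; elim/big_rec: _ => // i y _ y1.
  by apply: mulr_ege1 => //; rewrite lerDl exprn_ge0.
have: e N <= P N * (B * N.+1%:R * h ^+ (N %/ a)).
  elim: N => [|N IHN]; first by rewrite /P big_ord0 div0n expr0 !mulr1 mul1r.
  apply: le_trans (eS N) _.
  have -> : P N.+1 * (B * N.+2%:R * h ^+ (N.+1 %/ a)) =
      P N.+1 * (B * N.+1%:R * h ^+ (N.+1 %/ a)) + P N.+1 * (B * h ^+ (N.+1 %/ a)).
    by rewrite -[N.+2%:R]natr1; ring.
  apply: lerD; last first.
    by rewrite -[leLHS]mul1r ler_wpM2r ?P1 // mulr_ge0 // exprn_ge0.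
  have x2 : 0 <= 1 + x ^+ N.+1 by rewrite addr_ge0 ?exprn_ge0.
  apply: le_trans (ler_wpM2l x2 IHN) _.
  have -> : P N.+1 = (1 + x ^+ N.+1) * P N by rewrite /P big_ord_recr mulrC.
  rewrite -[leRHS]mulrA ler_wpM2l // ler_wpM2l ?(le_trans _ (P1 N)) //.
  rewrite ler_wpM2l ?mulr_ge0 ?ler0n // ler_weXn2l // leq_div2r //.
move/le_trans; apply; rewrite -!mulrA ler_wpM2r ?prod_1X_bounded //.
by rewrite !mulr_ge0 ?ler0n ?exprn_ge0.
Qed.

End Growth.

(** * The tail of the q-exponential series *)

(** The general term of the series of step [a] at [x], indexed by the argument
    [N] of the q-factorial in its denominator. *)
Definition dilate (A : nzRingType) (x : A) (a N : nat) : A :=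
  if (a %| N)%N then x ^+ (N %/ a) else 0.

Section Tail.
Variables (R : realType) (q : R).
Hypothesis q_gt1 : 1 < `|q|.
Implicit Types (x : R) (b : nat -> R).

Lemma qfact0 : qfact q 0 = 1.
Proof. by rewrite /qfact big_geq. Qed.

Lemma qfactS n : qfact q n.+1 = qfact q n * (q ^+ n.+1 - 1).
Proof. by rewrite /qfact big_nat_recr. Qed.

(** Bernoulli's inequality. *)
Lemma expr_norm_large (C : R) :
  exists N0, forall N, (N0 <= N)%N -> C <= `|q| ^+ N.+1 - 1.
Proof.
have e0 : 0 < `|q| - 1 by rewrite subr_gt0.
have bern N : N%:R * (`|q| - 1) <= `|q| ^+ N - 1.
  elim: N => [|N IHN]; first by rewrite mul0r expr0 subrr.
  have Q1 : 1 <= `|q| ^+ N by rewrite exprn_ege1 // ltW.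
  rewrite -natr1 exprS; nra.
exists (Num.truncn (`|C| / (`|q| - 1))) => N leN; apply: le_trans (bern _).
apply: le_trans (ler_norm C) _; rewrite -ler_pdivrMr //.
by apply: ltW; apply: lt_le_trans (truncnS_gt _) _; rewrite ler_nat.
Qed.

Lemma norm_exprB1 N i : (N <= i)%N -> `|q| ^+ N - 1 <= `|q ^+ i - 1|.
Proof.
move=> leNi; apply: (@le_trans _ _ (`|q| ^+ i - 1)).
  by rewrite lerB // ler_weXn2l // ltW.
by rewrite -normrX -[X in _ - X]normr1 lerB_dist.
Qed.

(** Every factor of the q-factorial past the [N]-th has absolute value at least
    [`|q| ^+ N.+1 - 1]. *)
Lemma qfact_ge N t :
  `|qfact q N| * (`|q| ^+ N.+1 - 1) ^+ t <= `|qfact q (N + t)|.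
Proof.
have B0 : 0 <= `|q| ^+ N.+1 - 1 by rewrite subr_ge0 exprn_ege1 // ltW.
elim: t => [|t IHt]; first by rewrite mulr1 addn0.
rewrite addnS qfactS normrM exprSr mulrA.
by apply: ler_pM; rewrite ?mulr_ge0 ?exprn_ge0 ?norm_exprB1 // ltnS leq_addr.
Qed.

Lemma qfact_neq0 n : qfact q n != 0.
Proof.
elim: n => [|n IHn]; first by rewrite qfact0 oner_neq0.
rewrite qfactS mulf_neq0 // -normr_gt0.
apply: lt_le_trans (norm_exprB1 (leqnn _)).
by rewrite subr_gt0 exprn_egt1.
Qed.

Lemma eventually_bounded (f : nat -> R) (K : R) (N : nat) :
    (forall n, (N <= n)%N -> f n <= K) ->
  exists2 K', 0 <= K' & forall n, f n <= K'.
Proof.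
move=> fK; exists (`|K| + \sum_(i < N) `|f i|) => [|n].
  by rewrite addr_ge0 // sumr_ge0.
have [ltnN | /fK] := ltnP n N.
  rewrite (bigD1 (Ordinal ltnN)) //= addrCA.
  by apply: le_trans (ler_norm _) _; rewrite lerDl addr_ge0 // sumr_ge0.
move/le_trans; apply; apply: le_trans (ler_norm _) _.
by rewrite lerDl sumr_ge0.
Qed.

(** The q-factorial of [a * n] eventually dominates [(2 * `|x|) ^+ n], so the
    general term is O(2^-n). *)
Lemma cvg_qexp_series x (a : nat) : (0 < a)%N ->
  cvgn (fun N => \sum_(1 <= n < N) x ^+ n / qfact q (a * n)).
Proof.
move=> a0; have [N0 N0P] := expr_norm_large (2%:R * (1 + `|x|)).
pose B := `|q| ^+ N0.+1 - 1.
have xB : 2%:R * (1 + `|x|) <= B by apply: N0P.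
have x0 : 0 <= `|x| by [].
have B1 : 1 <= B by lra.
have B0 : 0 < B by lra.
pose u n := x ^+ n / qfact q (a * n).
have [K K0 KP] : exists2 K, 0 <= K & forall n, `|u n| * 2%:R ^+ n <= K.
  apply: (@eventually_bounded _ (B ^+ N0 / `|qfact q N0|) N0) => n leNn.
  have lean : (n <= a * n)%N by rewrite leq_pmull.
  have qN0 : 0 < `|qfact q N0| by rewrite normr_gt0 qfact_neq0.
  have qan0 : 0 < `|qfact q (a * n)| by rewrite normr_gt0 qfact_neq0.
  rewrite /u normrM normfV normrX mulrAC ler_pdivrMr // mulrAC ler_pdivlMr //.
  rewrite -exprMn.
  apply: (@le_trans _ _ (B ^+ n * `|qfact q N0|)).
    by rewrite ler_wpM2r // lerXn2r ?nnegrE ?(ltW B0) ?mulr_ge0 //; lra.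
  have := qfact_ge N0 (a * n - N0); rewrite subnKC ?(leq_trans leNn) // -/B.
  move/(ler_wpM2l (exprn_ge0 N0 (ltW B0))); apply: le_trans.
  rewrite mulrCA mulrC ler_wpM2l // -exprD; apply: ler_weXn2l => //; lia.
suff: cvgn (series (fun n => u n.+1)).
  move=> /cvg_ex[l /= ul]; apply/cvg_ex; exists l.
  rewrite -cvg_shiftS; apply: cvg_trans ul; apply: near_eq_cvg.
  by apply: nearW => N; rewrite /series /= big_add1.
apply: normed_cvg.
apply: (@series_le_cvg _ _ (geometric K 2^-1)) => //.
- by move=> n; apply: normr_ge0.
- by move=> n; apply: geometric_ge0 => //; rewrite invr_ge0.
- move=> n /=; rewrite exprVn -ler_pdivrMr ?invr_gt0 ?exprn_gt0 // invrK.
  apply: le_trans (KP n.+1); rewrite ler_wpM2l // ler_weXn2l // ?ler1n //.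
- apply: is_cvg_geometric_series; rewrite ger0_norm ?invr_ge0 //.
  by rewrite invf_lt1 // ltr1n.
Qed.

Lemma sum_dilate x (a N : nat) : (0 < a)%N ->
  \sum_(m < N.+1) dilate x a m / qfact q m =
  1 + \sum_(1 <= n < (N %/ a).+1) x ^+ n / qfact q (a * n).
Proof.
move=> a0; elim: N => [|N IHN].
  rewrite big_ord1 div0n big_geq // /dilate dvdn0 div0n qfact0.
  by rewrite divr1 addr0.
rewrite big_ord_recr /= {}IHN divnS // /dilate.
have [adiv | _] := boolP (a %| N.+1)%N; last by rewrite mul0r addr0.
rewrite add1n [in RHS]big_nat_recr //= addrA; congr (_ + _).
have -> : N.+1 = (a * (N %/ a).+1)%N.
  by rewrite -[LHS](divnK adiv) divnS // adiv mulnC.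
by rewrite mulKn.
Qed.

Lemma cleared_sumE b N :
  cleared_sum q b N = qfact q N * \sum_(m < N.+1) b m / qfact q m.
Proof.
elim: N => [|N IHN]; first by rewrite big_ord1 qfact0 mul1r divr1.
rewrite big_ord_recr /= mulrDr [X in _ = _ + X]mulrC divfK ?qfact_neq0 //.
by rewrite IHN qfactS mulrA [_ * qfact q N]mulrC.
Qed.

(** A limit 0 lets one sum the increments of [v] from [N] to infinity. *)
Lemma telescope_tail (v : nat -> R) (N : nat) (K : R) : 0 <= K ->
    v @ \oo --> 0 ->
    (forall t, `|v (N + t).+1 - v (N + t)%N| <= K * 2^-1 ^+ t) ->
  `|v N| <= K * 2%:R.
Proof.
move=> K0 v0 vK.
have bound t : `|v N| <= `|v (N + t)%N| + K * (\sum_(i < t) 2^-1 ^+ i).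
  elim: t => [|t IHt]; first by rewrite addn0 big_ord0 mulr0 addr0.
  have step : `|v (N + t)%N| <= `|v (N + t).+1| + K * 2^-1 ^+ t.
    rewrite -lerBlDl; apply: le_trans (vK t); rewrite distrC.
    exact: lerB_dist.
  apply: le_trans IHt _; rewrite big_ord_recr /= mulrDr addnS; lra.
have geo t : \sum_(i < t) 2^-1 ^+ i <= 2%:R :> R.
  have : (2^-1 - 1) * (\sum_(i < t) 2^-1 ^+ i) = 2^-1 ^+ t - 1 :> R by rewrite subrX1.
  have : 0 <= 2^-1 ^+ t :> R by rewrite exprn_ge0 // invr_ge0.
  lra.
apply/ler_addgt0Pr => e e0.
have /cvgrPdist_lt/(_ e e0)[n0 _ n0P] := v0.
have := n0P (N + n0)%N; rewrite /= sub0r normrN => /(_ (leq_addl _ _)) ltv.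
apply: le_trans (bound n0) _; rewrite addrC lerD ?(ltW ltv) //.
by rewrite ler_wpM2l.
Qed.

(** As the series sums to 0, the partial sum up to [N] is minus the tail. Let
    [B = `|q| ^+ N.+1 - 1]. From one term of the tail to the next, the bound on
    the numerator grows at most by the factor [h] and the denominator at least
    by the factor [B >= 2 * h], so the tail is at most twice the bound on its
    first term, which is [Kb * h ^+ (N %/ a) * h / (`|qfact q N| * B)]. *)
Lemma cleared_sum_tail b (h Kb : R) (a : nat) : (0 < a)%N -> 1 <= h -> 0 <= Kb ->
    (forall m, `|b m| <= Kb * h ^+ (m %/ a)) ->
    (fun N => \sum_(m < N.+1) b m / qfact q m) @ \oo --> 0 ->
  exists K N0, 0 <= K /\ forall N, (N0 <= N)%N ->
    `|cleared_sum q b N| <= K * (h / `|q| ^+ a) ^+ (N %/ a).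
Proof.
move=> a0 h1 Kb0 bK v0; set v := (fun N => _) in v0.
have h0 : 0 <= h by lra.
have e0 : 0 < `|q| - 1 by rewrite subr_gt0.
have [N0 N0P] := expr_norm_large (2%:R * h).
exists (2%:R * Kb * h / (`|q| - 1)), N0; split.
  by rewrite !mulr_ge0 // invr_ge0 ltW.
move=> N leN; pose B := `|q| ^+ N.+1 - 1.
have hB : 2%:R * h <= B by apply: N0P.
have B0 : 0 < B by lra.
have qN0 : 0 < `|qfact q N| by rewrite normr_gt0 qfact_neq0.
pose K := Kb * h ^+ (N %/ a) * h / (`|qfact q N| * B).
have K0 : 0 <= K by rewrite !mulr_ge0 ?exprn_ge0 // invr_ge0 mulr_ge0 // ltW.
have /(telescope_tail K0 v0) vN : forall t, `|v (N + t).+1 - v (N + t)%N| <= K * 2^-1 ^+ t.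
  move=> t; rewrite /v big_ord_recr /= addrAC subrr add0r normrM normfV.
  have qNt : 0 < `|qfact q (N + t).+1| by rewrite normr_gt0 qfact_neq0.
  rewrite ler_pdivrMr //; apply: le_trans (bK _) _.
  have gr := qfact_ge N t.+1; rewrite -/B addnS in gr.
  apply: le_trans (ler_wpM2l (mulr_ge0 K0 (exprn_ge0 t _)) gr); last by rewrite invr_ge0.
  have -> : K * 2^-1 ^+ t * (`|qfact q N| * B ^+ t.+1) =
      Kb * h ^+ (N %/ a) * h * (2^-1 * B) ^+ t.
    rewrite /K exprS exprMn; have B0' : B != 0 by rewrite gt_eqF.
    have qN0' : `|qfact q N| != 0 by rewrite gt_eqF.
    by field; rewrite qN0' B0'.
  rewrite -!mulrA ler_wpM2l //.
  apply: (@le_trans _ _ (h ^+ (N %/ a + t.+1))).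
    apply: ler_weXn2l => //; rewrite -addnS.
    by rewrite -ltnS ltn_divLR //; have := ltn_ceil N a0; nia.
  rewrite exprD ler_wpM2l ?exprn_ge0 // exprS ler_wpM2l //.
  rewrite lerXn2r ?nnegrE ?mulr_ge0 ?invr_ge0 ?(ltW B0) //; lra.
rewrite cleared_sumE normrM -/(v N).
apply: le_trans (ler_wpM2l (ltW qN0) vN) _.
have -> : `|qfact q N| * (K * 2) = 2%:R * Kb * h * h ^+ (N %/ a) / B.
  rewrite /K; have B0' : B != 0 by rewrite gt_eqF.
  have qN0' : `|qfact q N| != 0 by rewrite gt_eqF.
  by field; rewrite qN0' B0'.
rewrite expr_div_n -[leRHS]mulrA [(_)^-1 * _]mulrCA mulrA -[leLHS]mulrA.
rewrite -!mulrA !ler_wpM2l ?exprn_ge0 // -invfM lef_pV2 ?posrE //; last first.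
  by rewrite mulr_gt0 // !exprn_gt0 // (lt_trans _ q_gt1).
(* [a * (N %/ a) <= N], and [B >= (`|q| - 1) * `|q| ^+ N] since
   [`|q| ^+ N >= 1]. *)
rewrite -exprM /B.
have le1 : `|q| ^+ (a * (N %/ a)) <= `|q| ^+ N.
  by apply: ler_weXn2l; [exact: ltW | rewrite mulnC leq_trunc_div].
have le2 : 1 <= `|q| ^+ N by rewrite exprn_ege1 // ltW.
have le3 : (`|q| - 1) * `|q| ^+ (a * (N %/ a)) <= (`|q| - 1) * `|q| ^+ N.
  by rewrite ler_wpM2l // ltW.
apply: le_trans le3 _; rewrite exprS; nra.
Qed.

End Tail.

(** * The linear form *)

(** The index [None] stands for the constant 1, whose expansion along the
    inverse q-factorials has a single nonzero coefficient, at [N = 0]. *)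
Definition term_coef (A : nzRingType) (k : nat) (a : 'I_k -> nat) (x : A)
    (i : option 'I_k) (N : nat) : A :=
  if i is Some j then dilate x (a j) N else (N == 0%N)%:R.

(** The coefficient of the inverse of the [N]-th q-factorial in the linear form
    with coefficients [c]. *)
Definition form_coef (A : nzRingType) (k : nat) (a : 'I_k -> nat) (x : A)
    (c : option 'I_k -> A) (N : nat) : A :=
  \sum_i c i * term_coef a x i N.

Lemma rmorph_form_coef (A B : nzRingType) (f : {rmorphism A -> B}) k
    (a : 'I_k -> nat) x c N :
  f (form_coef a x c N) = form_coef a (f x) (f \o c) N.
Proof.
rewrite rmorph_sum; apply: eq_bigr => -[j|] _; rewrite rmorphM /=; last first.
  by rewrite rmorph_nat.
by rewrite /dilate; case: ifP; rewrite ?rmorphXn ?rmorph0.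
Qed.

Lemma integral_form_coef (A : comNzRingType) k (a : 'I_k -> nat) (x : A) c N :
    integralOver (intr : int -> A) x ->
    (forall i, integralOver (intr : int -> A) (c i)) ->
  integralOver (intr : int -> A) (form_coef a x c N).
Proof.
move=> x_int c_int.
rewrite /form_coef; elim/big_rec: _ => [|i y _]; first exact: mxpoly.integral0.
apply: integral_add; apply: integral_mul => //; case: i => [j|] /=; last exact: integral_nat.
rewrite /dilate; case: ifP => _; last exact: mxpoly.integral0.
elim: (_ %/ _)%N => [|n IHn]; first exact: integral1.
by rewrite exprS; apply: integral_mul.
Qed.

Lemma normc_form_coef_le (R : realType) k (a : 'I_k -> nat) (a1 : nat)
    (x : R[i]) (c : option 'I_k -> R[i]) N :
    (0 < a1)%N -> (forall j, (a1 <= a j)%N) ->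
  normc (form_coef a x c N) <=
    (\sum_i normc (c i)) * (Num.max 1 (normc x)) ^+ (N %/ a1).
Proof.
move=> a1_gt0 le_a1; set h := Num.max 1 _.
have h1 : 1 <= h by rewrite le_max lexx.
apply: (@le_trans _ _ (\sum_i normc (c i * term_coef a x i N))).
  rewrite /form_coef; elim/big_ind2: _ => //; first by rewrite ComplexField.Normc.normc0.
  by move=> y1 y2 z1 z2 le1 le2; apply: le_trans (normc_add _ _) _; apply: lerD.
rewrite mulr_suml; apply: ler_sum => i _.
rewrite ComplexField.Normc.normcM ler_wpM2l ?normc_ge0 //.
have le1 : 1 <= h ^+ (N %/ a1) by rewrite exprn_ege1.
case: i => [j|] /=; last first.
  case: (N == 0%N); rewrite ?ComplexField.Normc.normc1 ?ComplexField.Normc.normc0 //.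
  exact: le_trans le1.
rewrite /dilate; case: ifP => _; last by rewrite ComplexField.Normc.normc0 (le_trans _ le1).
rewrite normc_exp; apply: (@le_trans _ _ (h ^+ (N %/ a j))).
  have h0 : 0 <= h by apply: le_trans h1.
  by rewrite lerXn2r ?nnegrE ?normc_ge0 // le_max lexx orbT.
by apply: ler_weXn2l => //; apply: leq_div2l.
Qed.

(** Only finitely many series are added, and the truncation at [N] of the series
    of step [a j] is its partial sum up to [N %/ a j], which tends to infinity
    with [N]. *)
Lemma cvg_form_coef_sum (R : realType) (q x : R) k (a : 'I_k -> nat)
    (c : option 'I_k -> R) :
    1 < `|q| -> (forall j, (0 < a j)%N) ->
  (fun N => \sum_(m < N.+1) form_coef a x c m / qfact q m) @ \oo -->
  \sum_i c i * (if i is Some j then qexp q (a j) x else 1).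
Proof.
move=> q1 a0.
pose V i N : R := \sum_(m < N.+1) term_coef a x i m / qfact q m.
have -> : (fun N => \sum_(m < N.+1) form_coef a x c m / qfact q m) =
    (fun N => \sum_i c i * V i N).
  apply/funext => N; under [RHS]eq_bigr do rewrite /V mulr_sumr.
  rewrite exchange_big /=; apply: eq_bigr => m _.
  by rewrite /form_coef mulr_suml; apply: eq_bigr => i _; rewrite mulrA.
apply: cvg_big => [|i _]; first exact: add_continuous.
apply: cvgMl_tmp; case: i => [j|]; rewrite /V; last first.
  apply: cvg_near_cst; apply: nearW => N.
  rewrite big_ord_recl /= qfact0 divr1 big1 ?addr0 // => m _.
  by rewrite mul0r.
rewrite /qexp; under eq_cvg do rewrite sum_dilate //.
apply: cvgD; first exact: cvg_cst.
have div_oo : (fun N => (N %/ a j).+1) @ \oo --> \oo.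
  apply/cvgnyPge => A; exists (A * a j)%N => // N /= leN.
  by apply: leqW; rewrite leq_divRL.
pose S n := \sum_(1 <= i < n) x ^+ i / qfact q (a j * i).
exact: (@cvg_comp _ _ _ (fun N => (N %/ a j).+1) S _ _ _ div_oo
  (cvg_qexp_series q1 (x := x) (a0 j))).
Qed.

(** If [L] is a multiple of all the [a i] and [N] is [a j] plus a multiple of
    [L], then [a i] divides [N] exactly when it divides [a j]. Since [a] is
    increasing, this happens only for [i <= j], and the terms with [i < j] are 0
    by induction; what remains is [c (Some j)] times a power of [x]. *)
Lemma eventually0_form_coef (A : idomainType) k (a : 'I_k -> nat) (x : A)
    (c : option 'I_k -> A) (N0 : nat) :
    x != 0 -> (forall j, (0 < a j)%N) ->
    (forall i j : 'I_k, (i < j)%N -> (a i < a j)%N) ->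
    (forall N, (N0 < N)%N -> form_coef a x c N = 0) ->
  forall j, c (Some j) = 0.
Proof.
move=> x0 a0 a_incr c0 j.
have [n] := ubnP (val j); elim: n j => // n IHn j ltjn.
pose L := (\prod_i a i)%N.
have L0 : (0 < L)%N by apply: prodn_gt0.
have aL i : (a i %| L)%N by rewrite /L (bigD1 i) //= dvdn_mulr.
pose N := (a j + L * N0.+1)%N.
have dvdN i : (a i %| N)%N = (a i %| a j)%N.
  by rewrite /N dvdn_addl // dvdn_mulr.
have ltN : (N0 < N)%N.
  by rewrite /N; apply: leq_trans (leq_addl _ _); apply: leq_pmull.
have := c0 N ltN; rewrite /form_coef (bigD1 (Some j)) //= big1 => [|i ij]; last first.
  case: i ij => [i|] ij /=; last first.
    have -> : (N == 0)%N = false by rewrite /N addn_eq0 eqn0Ngt a0.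
    by rewrite mulr0.
  rewrite /dilate dvdN; case: ifP => [adiv|]; last by rewrite mulr0.
  have lt_ij : (i < j)%N.
    rewrite ltn_neqAle; apply/andP; split.
      by apply: contra ij => /eqP/val_inj->.
    by rewrite leqNgt; apply/negP => /a_incr; rewrite ltnNge dvdn_leq.
  by rewrite IHn ?mul0r // (leq_trans lt_ij).
rewrite addr0 /dilate dvdN dvdnn => /eqP; rewrite mulf_eq0 expf_eq0 (negPf x0).
by rewrite andbF orbF => /eqP.
Qed.

(** The norm of [cleared_sum] is at most a constant times
    [N.+1 ^+ d * rho ^+ (N %/ a1)], where [d] is the number of embeddings and
    [rho = rel_height alpha / `|q| ^+ a1] is less than 1 by the hypothesis on the
    height. Hence it is eventually less than 1, which is impossible for a nonzero
    algebraic integer. *)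
Lemma cleared_sum_eventually0 (R : realType) (q : R) k (a : 'I_k -> nat) (a1 : nat)
    (alpha : adjoin q) (c : option 'I_k -> adjoin q) :
    PV_number q \/ PV_number (- q) ->
    (0 < a1)%N -> (forall j, (a1 <= a j)%N) ->
    ring_of_integers q alpha -> rel_height alpha < `|q| ^+ a1 ->
    (forall i, ring_of_integers q (c i)) ->
    \sum_i val (c i) * (if i is Some j then qexp q (a j) (val alpha) else 1) = 0 ->
  exists N0, forall N, (N0 <= N)%N -> cleared_sum (adjoin_gen q) (form_coef a alpha c) N = 0.
Proof.
move=> /PV_conjugates[q_int q1 conj] a1_gt0 le_a1 alpha_int ltH c_int rel0.
have a0 j : (0 < a j)%N by apply: leq_trans (le_a1 j).
have [ss [ss_uniq ssE ss_norm]] := embeddings_enum q_int.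
pose s1 : {rmorphism adjoin q -> R[i]} := real_complex R \o val.
have s1E y : normc (s1 y) = `|val y| by exact: normc_real.
have s1_in : (s1 : adjoin q -> R[i]) \in ss.
  have : embeddings q s1 by exists s1.
  by rewrite ssE.
have ssP s : s \in ss -> embeddings q s by rewrite ssE.
pose b := form_coef a alpha c.
pose h (s : adjoin q -> R[i]) := Num.max 1 (normc (s alpha)).
have h1 s : 1 <= h s by rewrite le_max lexx.
have h0 s : 0 <= h s by apply: le_trans (h1 s).
have heightE : rel_height alpha = \prod_(s <- ss) h s.
  by rewrite /rel_height ssE -fsbig_seq.
(* The saving at the real place, attached to [s1] so that all the embeddings
   satisfy a bound of the same shape. *)
pose D (s : adjoin q -> R[i]) : R := if s == s1 then (`|q| ^+ a1)^-1 else 1.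
have q0 : 0 < `|q| by apply: lt_trans q1.
have D0 s : 0 <= D s by rewrite /D; case: ifP => // _; rewrite invr_ge0 exprn_ge0.
pose Kb (s : adjoin q -> R[i]) := \sum_i normc (s (c i)).
have Kb0 s : 0 <= Kb s by apply: sumr_ge0 => i _; apply: normc_ge0.
have bound s : s \in ss -> exists K N0, 0 <= K /\ forall N, (N0 <= N)%N ->
    normc (s (cleared_sum (adjoin_gen q) b N)) <= K * N.+1%:R * (h s * D s) ^+ (N %/ a1).
  move=> /[dup] s_in /ssP /[dup] /conj s_conj [f fE].
  have bs N : normc (s (b N)) <= Kb s * h s ^+ (N %/ a1).
    rewrite fE rmorph_form_coef; exact: normc_form_coef_le.
  have [s_eq | s_neq] := eqVneq s s1.
    pose bR N := val (b N).
    have bRn m : `|bR m| <= Kb s * h s ^+ (m %/ a1).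
      by apply: le_trans (bs m); rewrite s_eq s1E.
    have v0 : (fun N => \sum_(m < N.+1) bR m / qfact q m) @ \oo --> 0.
      have := cvg_form_coef_sum (x := val alpha) (c := val \o c) q1 a0.
      rewrite /= rel0; apply: cvg_trans; apply: near_eq_cvg; apply: nearW => N.
      by apply: eq_bigr => m _; rewrite /bR [val (b m)]rmorph_form_coef.
    have [K [N0 [K0 KP]]] := cleared_sum_tail q1 a1_gt0 (h1 s) (Kb0 s) bRn v0.
    exists K, N0; split=> // N leN.
    have -> : normc (s (cleared_sum (adjoin_gen q) b N)) = `|cleared_sum q bR N|.
      by rewrite s_eq s1E [val _]rmorph_cleared_sum.
    apply: le_trans (KP N leN) _; rewrite /D s_eq eqxx -mulrA ler_wpM2l //.
    rewrite -[leLHS]mul1r ler_wpM2r ?ler1n // exprn_ge0 // divr_ge0 // exprn_ge0 //.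
  have {s_conj} r1 : normc (s (adjoin_gen q)) < 1.
    by case: s_conj => // s_eq; move: s_neq; rewrite s_eq eqxx.
  have [||K K0 KP] := @recurrence_growth R (normc (s (adjoin_gen q))) (h s) (Kb s) a1
      (fun N => normc (s (cleared_sum (adjoin_gen q) b N))) (normc_ge0 _) r1 (h1 s) (Kb0 s).
  - by have := bs 0%N; rewrite div0n mulr1.
  - move=> N; rewrite /= fE rmorphD rmorphM rmorphB rmorph1 rmorphXn -fE.
    apply: le_trans (normc_add _ _) _; apply: lerD; last exact: bs.
    rewrite ComplexField.Normc.normcM ler_wpM2r ?normc_ge0 //.
    rewrite addrC; apply: le_trans (normc_add _ _) _.
    by rewrite normc_opp ComplexField.Normc.normc1 normc_exp lexx.
  - exists K, 0%N; split=> // N _; apply: le_trans (KP N) _.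
    by rewrite /D (negPf s_neq) mulr1.
have /choice[KN KNP] : forall s, exists KN : R * nat, s \in ss ->
    0 <= KN.1 /\ forall N, (KN.2 <= N)%N ->
    normc (s (cleared_sum (adjoin_gen q) b N)) <= KN.1 * N.+1%:R * (h s * D s) ^+ (N %/ a1).
  move=> s; have [s_in | s_nin] := boolP (s \in ss).
    by have [K [N0 KP]] := bound s s_in; exists (K, N0).
  by exists (0, 0%N).
pose rho := rel_height alpha / `|q| ^+ a1.
have rhoE : rho = \prod_(s <- ss) (h s * D s).
  rewrite big_split /= -heightE [\prod_(s <- ss) D s](bigD1_seq _ s1_in ss_uniq) /=.
  rewrite /D eqxx big1 ?mulr1 // => s /negPf->.
  by [].
have rho0 : 0 <= rho by rewrite rhoE; apply: prodr_ge0 => s _; rewrite mulr_ge0.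
have rho1 : rho < 1 by rewrite ltr_pdivrMr ?mul1r // exprn_gt0.
pose K := \prod_(s <- ss) (KN s).1; pose d := size ss.
have [m0 m0P] := poly_geom_small d (K * a1%:R ^+ d) rho0 rho1.
(* [m0 * a1] makes the exponent [N %/ a1] at least [m0]; the maximum makes the
   bound of every embedding valid. *)
exists (maxn (m0 * a1) (\max_(s <- ss) (KN s).2))%N => N.
rewrite geq_max => /andP[leN1 leN2].
apply/eqP/negPn/negP => sum_neq0.
have sum_int : integralOver (intr : int -> adjoin q) (cleared_sum (adjoin_gen q) b N).
  by apply: integral_cleared_sum => [|n]; [exact: integral_adjoin_gen | exact: integral_form_coef].
have := ss_norm _ sum_int sum_neq0; rewrite leNgt => /negP; apply.
pose m := (N %/ a1)%N.
have lem : (m0 <= m)%N by rewrite leq_divRL.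
apply: le_lt_trans (m0P m lem).
apply: (@le_trans _ _ (\prod_(s <- ss) ((KN s).1 * N.+1%:R * (h s * D s) ^+ m))).
  rewrite big_seq [leRHS]big_seq; apply: ler_prod => s s_in.
  rewrite normc_ge0 /=; apply: (KNP s s_in).2.
  by apply: leq_trans leN2; apply: (@leq_bigmax_seq _ ss xpredT (fun s => (KN s).2)).
have K0 : 0 <= K.
  by rewrite /K big_seq; apply: prodr_ge0 => s s_in; case: (KNP s s_in).
rewrite big_split /= big_split /= prodrXl -rhoE -/K.
have -> : \prod_(s <- ss) N.+1%:R = N.+1%:R ^+ d :> R.
  by rewrite big_const_seq count_predT iter_mulr_1.
rewrite -!mulrA ler_wpM2l // mulrA ler_wpM2r ?exprn_ge0 // -exprMn.
rewrite lerXn2r ?nnegrE ?mulr_ge0 ?ler0n // -natrM ler_nat.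
by rewrite mulnC; apply: ltn_ceil.
Qed.

Theorem theorem1p2 (R : realType) (q : R) (k : nat) (k_gt0 : (0 < k)%N)
    (a : 'I_k -> nat) (alpha : adjoin q) :
  PV_number q \/ PV_number (- q) ->
  (forall i : 'I_k, (0 < a i)%N) ->
  (forall i j : 'I_k, (i < j)%N -> (a i < a j)%N) ->
  ring_of_integers q alpha ->
  1 <= `|val alpha| ->
  rel_height alpha < `|q| ^+ a (Ordinal k_gt0) ->
  lin_indep_over q
    (fun i : option 'I_k =>
       if i is Some j then qexp q (a j) (val alpha) else 1).
Proof.
move=> PVq a_gt0 a_incr alpha_int alpha_ge1 ltH c rel0.
have [q_int _ _] := PV_conjugates PVq.
have [D D0 Dc_int] := adjoin_common_denominator c q_int.
pose Dc i := D%:~R * c i.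
have DR0 : D%:~R != 0 :> R by rewrite intr_eq0.
have D0' : D%:~R != 0 :> adjoin q.
  apply: contraNneq DR0 => /(congr1 val); rewrite [val _]rmorph_int => ->.
  by rewrite rmorph0.
have Dc_eq0 i : Dc i = 0 -> c i = 0.
  by move/eqP; rewrite mulf_eq0 (negPf D0') => /eqP.
have Drel0 : \sum_i val (Dc i) *
    (if i is Some j then qexp q (a j) (val alpha) else 1) = 0.
  have := congr1 (fun t => val (D%:~R : adjoin q) * t) rel0.
  rewrite mulr0 mulr_sumr => D_rel0; rewrite -[RHS]D_rel0.
  by apply: eq_bigr => i _; rewrite [val (Dc i)]rmorphM mulrA.
have le_a1 j : (a (Ordinal k_gt0) <= a j)%N.
  case: (posnP (val j)) => [j0 | /(a_incr (Ordinal k_gt0) j)/ltnW //].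
  by have -> : Ordinal k_gt0 = j by apply: val_inj.
have [N0 N0P] := cleared_sum_eventually0 PVq (a_gt0 _) le_a1 alpha_int ltH Dc_int Drel0.
have alpha0 : alpha != 0.
  by apply: contraTneq alpha_ge1 => ->; rewrite rmorph0 normr0 ler10.
have coef0 N : (N0 < N)%N -> form_coef a alpha Dc N = 0.
  case: N => // N leN; have := N0P N.+1 (ltnW leN).
  by rewrite /= N0P // mulr0 add0r.
have c_Some j : c (Some j) = 0.
  exact/Dc_eq0/(eventually0_form_coef alpha0 a_gt0 a_incr coef0).
case=> [j|]; first exact: c_Some.
move: rel0; rewrite (bigD1 None) //= mulr1 big1 ?addr0.
  by move=> c_None; apply: val_inj; rewrite rmorph0; exact: c_None.
case=> // j _; rewrite c_Some (_ : adjoin_val 0 = 0) ?mul0r //; exact: (rmorph0 val).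
Qed.
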